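(* Let $(R,+,\cdot,0,1)$ be a unitary ring. The following three statements are equivalent. (i) The element $1+1$ admits an inverse in $R$. (ii) There is a unique IMM algebra $(R,\overline{()},\oplus,\cdot,1)$ (that is, unique operations $\overline{()}$ and $\oplus$ on $R$ which, together with the given multiplication $\cdot$ and identity $1$, form an IMM algebra) such that $\overline{a}=1-a$ and $a\oplus b=(\overline{1}\oplus 1)\cdot(a+b)$ for all $a,b\in R$. (iii) There is a unique IMM algebra $(R,\overline{()},\oplus,\cdot,1)$ (in the same sense) such that $\overline{a}=1-a$ and $a+b=(1+1)\cdot(a\oplus b)$ for all $a,b\in R$.
   Context: An IMM algebra (involutive medial monoid) is a system $(B,\overline{()},\oplus,\cdot,1)$, where $B$ is a set, $\overline{()}$ is a unary operation, $\oplus$ and $\cdot$ are binary operations on $B$ and $1\in B$, such that for all elements of $B$: (B1) $a\oplus a=a$; (B2) $a\oplus b=b\oplus a$; (B3) $(a\oplus b)\oplus(c\oplus d)=(a\oplus c)\oplus(b\oplus d)$; (B4) $a\cdot(b\cdot c)=(a\cdot b)\cdot c$; (B5) $a\cdot 1=a=1\cdot a$; (B6) $a\cdot(b\oplus c)=(a\cdot b)\oplus(a\cdot c)$ and $(a\oplus b)\cdot c=(a\cdot c)\oplus(b\cdot c)$; (B7) $\overline{\overline{a}}=a$; (B8) $\overline{a\oplus b}=\overline{a}\oplus\overline{b}$; (B9) $a\cdot\overline{1}=\overline{1}=\overline{1}\cdot a$; (B10) $\overline{a}\oplus a=\overline{1}\oplus 1$. A unitary ring $(R,+,\cdot,0,1)$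 is an associative ring with zero $0$ and multiplicative identity $1$, not assumed commutative (and possibly with $0=1$). *)

(* Defs.v *)
From mathcomp Require Import all_boot all_algebra.

Set Implicit Arguments.
Unset Strict Implicit.
Unset Printing Implicit Defensive.

Record is_IMM_algebra (B : Type) (bar : B -> B) (oplus mul : B -> B -> B)
    (one : B) : Prop := IsIMMAlgebra {
  imm_oplusxx : forall a, oplus a a = a;
  imm_oplusC : forall a b, oplus a b = oplus b a;
  imm_medial : forall a b c d,
    oplus (oplus a b) (oplus c d) = oplus (oplus a c) (oplus b d);
  imm_mulA : forall a b c, mul a (mul b c) = mul (mul a b) c;
  imm_mulx1 : forall a, mul a one = a;
  imm_mul1x : forall a, mul one a = a;
  imm_mulDr : forall a b c, mul a (oplus b c) = oplus (mul a b) (mul a c);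
  imm_mulDl : forall a b c, mul (oplus a b) c = oplus (mul a c) (mul b c);
  imm_barK : forall a, bar (bar a) = a;
  imm_barD : forall a b, bar (oplus a b) = oplus (bar a) (bar b);
  imm_mulx0 : forall a, mul a (bar one) = bar one;
  imm_mul0x : forall a, mul (bar one) a = bar one;
  imm_oplusNx : forall a, oplus (bar a) a = oplus (bar one) one
}.

(* Main.v *)
(* In each of (ii) and (iii), distributivity of the product over the mean forces
   h := bar 1 (+) 1 to be central, and idempotence or the relation at (0, 1)
   gives (1 + 1) * h = 1 on one side, hence on both.  Conversely, a two-sided
   inverse u of 1 + 1 is central, the mean u * (a + b) satisfies the axioms, and
   either relation forces this formula. *)
Require Import Defs.
From mathcomp Require Import all_boot all_algebra.
From Stdlib Require Import FunctionalExtensionality.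
Import GRing.Theory.
Local Open Scope ring_scope.

(** Since 1 + 1 commutes with every [a], a * u = u * (1 + 1) * a * u = u * a * (1 + 1) * u = u *
    a. *)
Lemma half_comm (R : pzRingType) (u : R) :
  u * (1 + 1) = 1 -> (1 + 1) * u = 1 -> forall a, GRing.comm a u.
Proof.
move=> u2 du a; rewrite /GRing.comm -[LHS]mul1r -u2 -mulrA.
by rewrite [_ * (a * u)]mulrA mulrDl mul1r -[a in a + a]mulr1 -mulrDr -mulrA du mulr1.
Qed.

Lemma half_double (R : pzRingType) (u : R) :
  u * (1 + 1) = 1 -> forall a, u * (a + a) = a.
Proof. by move=> u2 a; rewrite -[a in a + a]mul1r -mulrDl mulrA u2 mul1r. Qed.

Lemma mean_is_IMM_algebra (R : pzRingType) (u : R) :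
  u * (1 + 1) = 1 -> (1 + 1) * u = 1 ->
  is_IMM_algebra (fun a : R => 1 - a) (fun a b => u * (a + b))
    (fun a b => a * b) 1.
Proof.
move=> u2 du; have uC := half_comm _ _ u2 du; split.
- exact: half_double.
- by move=> a b; rewrite addrC.
- by move=> a b c d; rewrite -!mulrDr addrACA.
- exact: mulrA.
- exact: mulr1.
- exact: mul1r.
(* Centrality enters here: [u] has to move past the left factor [a]. *)
- by move=> a b c; rewrite mulrA uC -mulrA mulrDr.
- by move=> a b c; rewrite -mulrA mulrDl.
- by move=> a; rewrite subKr.
- by move=> a b; rewrite addrACA [RHS]mulrDr u2 -opprD mulrN.
- by move=> a; rewrite subrr mulr0.
- by move=> a; rewrite subrr mul0r.
- by move=> a; rewrite !subrK.
Qed.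

(** As [bar 1] is absorbing, both products expand to [oplus (bar 1) a]. *)
Lemma IMM_half_comm (R : pzRingType) (bar : R -> R) (oplus : R -> R -> R) :
  is_IMM_algebra bar oplus (fun a b => a * b) 1 ->
  forall a, GRing.comm a (oplus (bar 1) 1).
Proof.
move=> imm a; rewrite /GRing.comm (imm_mulDr imm) (imm_mulDl imm).
by rewrite (imm_mulx0 imm) (imm_mul0x imm) mulr1 mul1r.
Qed.

Theorem theorem5p3 (R : pzRingType) :
  [<-> exists u : R, u * (1 + 1) = 1 /\ (1 + 1) * u = 1;
       exists! ops : (R -> R) * (R -> R -> R),
         let: (bar, oplus) := ops in
         [/\ is_IMM_algebra bar oplus (fun a b : R => a * b) 1,
             forall a : R, bar a = 1 - a
           & forall a b : R, oplus a b = oplus (bar 1) 1 * (a + b)];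
       exists! ops : (R -> R) * (R -> R -> R),
         let: (bar, oplus) := ops in
         [/\ is_IMM_algebra bar oplus (fun a b : R => a * b) 1,
             forall a : R, bar a = 1 - a
           & forall a b : R, a + b = (1 + 1) * oplus a b]].
Proof.
have funext2 (f g : R -> R -> R) : (forall a b, f a b = g a b) -> f = g.
  by move=> fg; do 2![apply: functional_extensionality => ?].
split; [|split].
- case=> u [u2 du].
  exists (fun a => 1 - a, fun a b => u * (a + b)); split.
    split=> [||a b]; [exact: mean_is_IMM_algebra | by [] |].
    (* For the mean, [oplus (bar 1) 1] is u * (0 + 1), that is, [u] itself. *)
    by rewrite subrr add0r mulr1.
  case=> bar oplus [imm barE opE].
  congr pair; first by apply: functional_extensionality => a; rewrite barE.
  apply: funext2 => a b; rewrite opE; congr (_ * _).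
  (* Idempotence at 1 makes [oplus (bar 1) 1] a left inverse of 1 + 1; it therefore equals the right
     inverse [u]. *)
  have h2 : oplus (bar 1) 1 * (1 + 1) = 1 by rewrite -opE (imm_oplusxx imm).
  by rewrite -[LHS]mul1r -[X in X * u]h2 -mulrA du mulr1.
- case=> -[bar oplus] [[imm barE opE] _].
  have u2 : oplus (bar 1) 1 * (1 + 1) = 1 by rewrite -opE (imm_oplusxx imm).
  have du : (1 + 1) * oplus (bar 1) 1 = 1 by rewrite (IMM_half_comm _ _ _ imm).
  exists (bar, oplus); split; first by split=> // a b; rewrite opE mulrA du mul1r.
  case=> bar' oplus' [_ barE' opE'].
  congr pair; first by apply: functional_extensionality => a; rewrite barE barE'.
  (* Substituting (1 + 1) * oplus' a b for a + b lets the left inverse of 1 + 1 cancel. *)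
  by apply: funext2 => a b; rewrite opE opE' mulrA u2 mul1r.
- case=> -[bar oplus] [[imm barE opE] _].
  have du : (1 + 1) * oplus (bar 1) 1 = 1 by rewrite -opE barE subrr add0r.
  by exists (oplus (bar 1) 1); rewrite -(IMM_half_comm _ _ _ imm).
Qed.
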